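(* The constructions $S\mapsto(S,\widehat{E(S)},\beta^S)$ (on inverse semigroups) and $\theta\mapsto(\theta,\widehat\theta)$ (on semigroup homomorphisms) form a functor from the category $\mathbf{IS}$ of inverse semigroups and semigroup homomorphisms to the category $\mathbf{ISA_{lcH}}$ of inverse semigroup actions on locally compact Hausdorff spaces and proper action morphisms.
   Context: Partial maps: a partial map $f\colon X\supset D_f\to Y$ is a continuous map from an open subspace $D_f\subset X$ to $Y$. For $V\subset Y$, $f^{-1}(V):=\{x\in D_f: f(x)\in V\}$. $f$ is proper if $f^{-1}(C)$ is compact for every compact $C\subset Y$. Composition: $f_2\circ f_1$ has domain $f_1^{-1}(D_{f_2})$. An inverse semigroup is a semigroup $S$ in which every $s$ has a unique $s^*$ with $ss^*s=s$, $s^*ss^*=s^*$; $E(S)=\{e\in S:e^2=e\}$ is a commutative subsemigroup. $I(X)$ is the inverse semigroup of all homeomorphisms between open subspaces of $X$ under composition of partial maps. An inverse semigroup action $(S,X,\alpha)$ is an inverse semigroup $S$, a topological space $X$ and a semigroup homomorphism $\alpha\colon S\to I(X)$ with $\bigcup_{s}D^\alpha_s=X$, where $D^\alpha_s$ is the domain of $\alpha_s$. An action morphism $(\theta,\xi)\colon(S,X,\alpha)\to(T,Y,\beta)$ consists of a semigroup homomorphism $\theta\colon S\to T$ and a partial map $\xi\colon Y\supset D_\xi\to X$ such that (i) $\xi^{-1}(D^\alpha_s)=D^\beta_{\theta(s)}$ for every $s\in S$; (ii) $\alpha_s(\xi(y))=\xi(\beta_{\theta(s)}(y))$ for every $s\in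 S$, $y\in\xi^{-1}(D^\alpha_s)$. It is proper if $\xi$ is proper. Composition is $(\theta_2,\xi_2)\cdot(\theta_1,\xi_1):=(\theta_2\circ\theta_1,\xi_1\circ\xi_2)$ and identities are $(\mathrm{id}_S,\mathrm{id}_X)$. $\mathbf{ISA_{lcH}}$ is the category of inverse semigroup actions on locally compact Hausdorff spaces with proper action morphisms. Spectral action: $\widehat{E(S)}_0$ is the set of all semigroup homomorphisms $E(S)\to\{0,1\}$ (usual multiplication), a closed subspace of the product space $\{0,1\}^{E(S)}$ (with $\{0,1\}$ discrete); $\widehat{E(S)}:=\widehat{E(S)}_0\setminus\{0\}$, where $0$ is the constant zero homomorphism. For $e\in E(S)$ put $U^S_e:=\{\zeta\in\widehat{E(S)}:\zeta(e)=1\}$, and for $s\in S$ put $U^S_s:=U^S_{s^*s}$. The spectral action $(S,\widehat{E(S)},\beta^S)$ is given by the partial homeomorphisms $\beta^S_s\colon U^S_s\to U^S_{s^*}$, $\beta^S_s(\zeta)(e)=\zeta(s^*es)$. For a semigroup homomorphism $\theta\colon S\to T$, let $\theta_*\colon\widehat{E(T)}_0\to\widehat{E(S)}_0$, $\zeta\mapsto\zeta\circ\theta|_{E(S)}$. The partial map $\widehat\theta\colon\widehat{E(T)}\supset D_{\widehat\theta}\to\widehat{E(S)}$ has domain $D_{\widehat\theta}:=\theta_*^{-1}(\widehat{E(S)})$ and is given by $\widehat\theta(\zeta)=\theta_*(\zeta)$. *)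

(* Defs.v *)
From HB Require Import structures.
From mathcomp Require Import all_boot all_order all_algebra.
From mathcomp Require Import finmap all_classical.
From mathcomp Require Import topology_structure compact separation_axioms.
From mathcomp Require Import bool_topology function_spaces subtype_topology.
From mathcomp Require Import topology.

Set Implicit Arguments.
Unset Strict Implicit.
Unset Printing Implicit Defensive.

Local Open Scope classical_set_scope.
Local Open Scope group_scope.

Record category := Category {
  obj :> Type;
  hom : obj -> obj -> Type;
  idm : forall A, hom A A;
  cmp : forall A B C, hom B C -> hom A B -> hom A C;
  cmp1m : forall A B (f : hom A B), cmp (idm B) f = f;
  cmpm1 : forall A B (f : hom A B), cmp f (idm A) = f;
  cmpA : forall A B C D (h : hom C D) (g : hom B C) (f : hom A B),
    cmp h (cmp g f) = cmp (cmp h g) f }.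

Arguments idm {c} A.

Definition is_functor (C D : category) (Fo : C -> D)
    (Fm : forall A B : C, hom A B -> hom (Fo A) (Fo B)) : Prop :=
  (forall A : C, Fm A A (idm A) = idm (Fo A)) /\
  (forall (A B E : C) (g : hom B E) (f : hom A B),
     Fm A E (cmp g f) = cmp (Fm B E g) (Fm A B f)).

(* A partial map is encoded as a function into an option type, [None] meaning
   "undefined", so that Leibniz equality of partial maps is equality of domains
   and of values. *)
Section PartialMaps.
Context {X Y : topologicalType}.
Implicit Types f : X -> option Y.

Definition pdom f : set X := [set x | isSome (f x)].

Definition prestr f (x : pdom f) : Y :=
  oextract (set_mem (valP x) : isSome (f (val x))).

Definition ppreim f (V : set Y) : set X := f @^-1` (some @` V).

Definition is_pmap f : Prop := open (pdom f) /\ continuous (prestr (f := f)).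

Definition pproper f : Prop := forall C, compact C -> compact (ppreim f C).

End PartialMaps.

Definition pcomp {X Y Z : Type} (g : Y -> option Z) (f : X -> option Y)
  : X -> option Z := fun x => obind g (f x).

(* The underlying set of I(X): the inverse of the homeomorphism from [pdom f]
   onto its (open) image is the partial map [g] with domain that image. *)
Definition phomeo (X : topologicalType) : set (X -> option X) :=
  [set f | is_pmap f /\ exists g : X -> option X,
     is_pmap g /\ forall x y, f x = Some y <-> g y = Some x].

HB.mixin Record Semigroup_isInverse S of Semigroup S := {
  star : S -> S;
  mulKstar : forall s : S, s * star s * s = s;
  starKmul : forall s : S, star s * s * star s = star s;
  star_uniq : forall s t : S, s * t * s = s -> t * s * t = t -> t = star s
}.

#[short(type="invSemigroupType")]
HB.structure Definition InvSemigroup :=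
  { S of Semigroup_isInverse S & Semigroup S }.

Bind Scope group_scope with InvSemigroup.sort.

Section InvSemigroupTheory.
Variable S : invSemigroupType.
Implicit Types s t e f : S.

Lemma starK s : star (star s) = s.
Proof. by apply/esym/star_uniq; [exact: starKmul|exact: mulKstar]. Qed.

Lemma idem_starE e : e * e = e -> star e = e.
Proof. by move=> ee; apply/esym/star_uniq; rewrite !ee. Qed.

Lemma idem_mul e f : e * e = e -> f * f = f -> (e * f) * (e * f) = e * f.
Proof.
move=> ee ff; set x := star (e * f).
have h1 : e * f * x * (e * f) = e * f by exact: mulKstar.
have h2 : x * (e * f) * x = x by exact: starKmul.
have xE : f * x * e = x.
  apply: star_uniq.
    by move: h1; rewrite -!mulgA !(mulgA f f) ff !(mulgA e e) ee.
  by rewrite -!mulgA !(mulgA e e) ee !(mulgA f f) ff -[in RHS]h2 -!mulgA.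
have xx : x * x = x.
  by rewrite -{1}xE -{2}xE -[RHS]xE -[in RHS]h2 -!mulgA.
have -> : e * f = x by rewrite -(idem_starE xx) /x starK.
exact: xx.
Qed.

Lemma idem_comm e f : e * e = e -> f * f = f -> e * f = f * e.
Proof.
move=> ee ff; have efef := idem_mul ee ff; have fefe := idem_mul ff ee.
rewrite -[LHS]idem_starE //; apply/esym/star_uniq.
  by rewrite -!mulgA !(mulgA f f) ff !(mulgA e e) ee -{2}efef -!mulgA.
by rewrite -!mulgA !(mulgA e e) ee !(mulgA f f) ff -{2}fefe -!mulgA.
Qed.

Lemma idem_starmul s : (star s * s) * (star s * s) = star s * s.
Proof. by rewrite mulgA starKmul. Qed.

Lemma idem_mulstar s : (s * star s) * (s * star s) = s * star s.
Proof. by rewrite mulgA mulKstar. Qed.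

Lemma idem_conj s e : e * e = e ->
  (star s * e * s) * (star s * e * s) = star s * e * s.
Proof.
move=> ee; rewrite -!mulgA (mulgA s (star s)) (mulgA (s * star s) e).
rewrite (idem_comm (idem_mulstar s) ee) -!mulgA !(mulgA e e) ee.
by rewrite (mulgA s) mulKstar.
Qed.

Lemma conj_mul s e f : e * e = e ->
  star s * (e * f) * s = (star s * e * s) * (star s * f * s).
Proof.
move=> ee; rewrite -!mulgA (mulgA s (star s)) (mulgA e (s * star s)).
rewrite -(idem_comm (idem_mulstar s) ee).
by rewrite -!mulgA (mulgA s (star s)) (mulgA (star s) (s * star s)) (mulgA (star s) s)
  starKmul.
Qed.

End InvSemigroupTheory.

Definition idem_of (S : invSemigroupType) := {e : S | e * e == e}.

HB.instance Definition _ (S : invSemigroupType) := SubChoice.on (idem_of S).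

Lemma idem_closed (S : invSemigroupType) :
  mulg_closed [pred e : S | e * e == e].
Proof.
by move=> e f; rewrite !inE => /eqP ee /eqP ff; apply/eqP/idem_mul.
Qed.

HB.instance Definition _ (S : invSemigroupType) :=
  SubChoice_isSubSemigroup.Build S (fun e : S => e * e == e) (idem_of S)
    (@idem_closed S).

Lemma idem_morP (S T : invSemigroupType) (theta : {multiplicative S -> T})
  (e : idem_of S) : theta (val e) * theta (val e) == theta (val e).
Proof. by rewrite -gmulfM (eqP (valP e)). Qed.

Definition idem_mor (S T : invSemigroupType) (theta : {multiplicative S -> T})
    (e : idem_of S) : idem_of T :=
  exist _ (theta (val e)) (idem_morP theta e).

Definition idem_dom (S : invSemigroupType) (s : S) : idem_of S :=
  exist _ (star s * s) (introT eqP (idem_starmul s)).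

Definition idem_conjg (S : invSemigroupType) (s : S) (e : idem_of S)
    : idem_of S :=
  exist _ (star s * val e * s) (introT eqP (idem_conj s (eqP (valP e)))).

Section Spectrum.
Variable S : invSemigroupType.

Definition is_char : set {ptws idem_of S -> bool} :=
  [set z | forall e f : idem_of S, z (e * f) = z e && z f].

Definition spec0 : topologicalType := set_type is_char.

Definition spec0_fun (z : spec0) : idem_of S -> bool := val z.

Definition nonzero_char : set spec0 :=
  [set z | spec0_fun z <> (fun=> false)].

Definition spec : topologicalType := set_type nonzero_char.

Definition spec_fun (z : spec) : idem_of S -> bool := spec0_fun (val z).

Definition Uidem (e : idem_of S) : set spec := [set z | spec_fun z e].

Definition Uelt (s : S) : set spec := Uidem (idem_dom s).

Lemma conj_charP (s : S) (z : spec0) :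
  is_char (fun e => spec0_fun z (idem_conjg s e)).
Proof.
move=> e f; have zP : is_char (val z) by exact: set_mem (valP z).
rewrite -(zP (idem_conjg s e)); congr (spec0_fun z _); apply/val_inj.
by rewrite /= (conj_mul s _ (eqP (valP e))).
Qed.

Definition conj_char (s : S) (z : spec0) : spec0 :=
  exist (fun u => u \in is_char) _ (mem_set (conj_charP s z)).

Lemma conj_char_neq0 (s : S) (z : spec) :
  Uelt s z -> nonzero_char (conj_char s (val z)).
Proof.
move=> zs /(congr1 (fun h => h (idem_dom (star s)))).
suff -> : spec0_fun (conj_char s (val z)) (idem_dom (star s)) = true by [].
rewrite -[RHS]zs; congr (spec0_fun (val z) _); apply/val_inj.
by rewrite /= starK mulgA starKmul.
Qed.

Definition beta (s : S) (z : spec) : option spec :=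
  match pselect (Uelt s z) with
  | left zs => Some (exist (fun u => u \in nonzero_char)
                      (conj_char s (val z)) (mem_set (conj_char_neq0 zs)))
  | right _ => None
  end.

End Spectrum.

Arguments is_char : clear implicits.
Arguments nonzero_char : clear implicits.

Section DualMap.
Variables (S T : invSemigroupType) (theta : {multiplicative S -> T}).

Lemma pull_charP (z : spec0 T) :
  is_char S (fun e => spec0_fun z (idem_mor theta e)).
Proof.
move=> e f; have zP : is_char T (val z) by exact: set_mem (valP z).
rewrite -(zP (idem_mor theta e)); congr (spec0_fun z _); apply/val_inj.
exact: gmulfM.
Qed.

Definition pull_char (z : spec0 T) : spec0 S :=
  exist (fun u => u \in is_char S) _ (mem_set (pull_charP z)).

(* [insub] is defined exactly on the nonzero characters. *)
Definition dual_map (z : spec T) : option (spec S) :=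
  insub (pull_char (val z)).

End DualMap.

Record act_data := ActData {
  act_sgp : invSemigroupType;
  act_space : topologicalType;
  act_map : act_sgp -> act_space -> option act_space }.

Definition is_action (A : act_data) : Prop :=
  [/\ forall s, phomeo (act_map s : act_space A -> _),
      forall s t, act_map (s * t) = pcomp (@act_map A s) (act_map t) &
      \bigcup_(s in [set: act_sgp A]) pdom (act_map s) = [set: act_space A]].

Definition is_lcH_action (A : act_data) : Prop :=
  [/\ is_action A, locally_compact [set: act_space A] &
      hausdorff_space (act_space A)].

Record mor_data (A B : act_data) := MorData {
  mor_hom : {multiplicative act_sgp A -> act_sgp B};
  mor_map : act_space B -> option (act_space A) }.

Definition is_morphism (A B : act_data) (m : mor_data A B) : Prop :=
  let theta := mor_hom m in let xi := mor_map m in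
  [/\ is_pmap xi,
      forall s, ppreim xi (pdom (act_map s)) = pdom (act_map (theta s)) &
      forall s y, ppreim xi (pdom (act_map s)) y ->
        pcomp (act_map s) xi y = pcomp xi (act_map (theta s)) y].

Definition is_proper_morphism (A B : act_data) (m : mor_data A B) : Prop :=
  is_morphism m /\ pproper (mor_map m).

Definition spectral_act (S : invSemigroupType) : act_data :=
  ActData (@beta S).

Definition spectral_mor (S T : invSemigroupType)
    (theta : {multiplicative S -> T})
    : mor_data (spectral_act S) (spectral_act T) :=
  @MorData (spectral_act S) (spectral_act T) theta (dual_map theta).

Lemma multiplicative_eq (S T : invSemigroupType)
  (f g : {multiplicative S -> T}) : f =1 g -> f = g.
Proof.
case: f g => [f [[fM]]] [g [[gM]]] /= /funext fg.
by move: fM gM; rewrite fg => fM gM; rewrite (Prop_irrelevance fM gM).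
Qed.

Definition mul_id (S : invSemigroupType) : {multiplicative S -> S} := idfun.

Definition mul_comp (S T U : invSemigroupType) (g : {multiplicative T -> U})
  (f : {multiplicative S -> T}) : {multiplicative S -> U} := g \o f.

Definition IS : category.
Proof.
refine (@Category invSemigroupType (fun S T => {multiplicative S -> T})
  mul_id mul_comp _ _ _) => *; exact: multiplicative_eq.
Defined.

Section PartialMapTheory.
Context {X Y : topologicalType}.

Lemma ppreimE (f : X -> option Y) V x :
  ppreim f V x <-> exists2 y, f x = Some y & V y.
Proof. by split=> [[y Vy fx]|[y fx Vy]]; exists y. Qed.

Lemma ppreimT (f : X -> option Y) : ppreim f setT = pdom f.
Proof.
apply/seteqP; split=> x; rewrite ppreimE /pdom /=; first by move=> [y ->].
by case: (f x) => // y _; exists y.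
Qed.

Lemma is_pmapP (f : X -> option Y) :
  is_pmap f <-> forall V, open V -> open (ppreim f V).
Proof.
have ppE (V : set Y) : ppreim f V = set_val @` (prestr (f := f) @^-1` V).
  apply/seteqP; split=> x.
    move=> /ppreimE[y fx Vy].
    have xD : x \in pdom f by apply/mem_set; rewrite /pdom /= fx.
    exists (exist _ x xD) => //=; rewrite /prestr.
    set v := oextract _; suff -> : v = y by [].
    by apply: Some_inj; rewrite Some_oextract /= fx.
  move=> [[u uD] Vu <-]; exists (prestr (exist _ u uD)) => //.
  by rewrite Some_oextract.
split=> [[oD /continuousP cf] V oV|h].
  have [W oW WE] := cf _ oV.
  suff -> : ppreim f V = pdom f `&` W by exact: openI.
  rewrite ppE -WE; apply/seteqP; split=> x.
    by move=> [[u uD] Wu <-]; split=> //; exact: set_mem.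
  by move=> [/mem_set xD Wx]; exists (exist _ x xD).
split; first by rewrite -ppreimT; exact/h/openT.
apply/continuousP => V oV; exists (ppreim f V); first exact: h.
rewrite ppE; apply/seteqP; split=> x; last by move=> Vx; exists x.
by move=> [u Vu /val_inj <-].
Qed.

End PartialMapTheory.

Section PartialMapComposition.
Context {X Y Z : topologicalType}.

Lemma ppreim_comp (g : Y -> option Z) (f : X -> option Y) V :
  ppreim (pcomp g f) V = ppreim f (ppreim g V).
Proof.
apply/seteqP; split=> x; rewrite /ppreim /pcomp /=.
  case fx: (f x) => [y|] /= [z Vz // gy].
  by exists y => //; exists z.
by move=> [y [z Vz gy] <-]; exists z.
Qed.

Lemma is_pmap_comp (g : Y -> option Z) (f : X -> option Y) :
  is_pmap g -> is_pmap f -> is_pmap (pcomp g f).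
Proof.
by move=> /is_pmapP gP /is_pmapP fP; apply/is_pmapP => V oV;
  rewrite ppreim_comp; exact/fP/gP.
Qed.

Lemma ppreim_id (V : set X) : ppreim some V = V.
Proof. by apply/seteqP; split=> x; [move=> [y Vy [<-]]|move=> Vx; exists x]. Qed.

Lemma is_pmap_id : is_pmap (some : X -> option X).
Proof. by apply/is_pmapP => V; rewrite ppreim_id. Qed.

End PartialMapComposition.

Definition mor_id (A : act_data) : mor_data A A := MorData (mul_id _) some.

Definition mor_comp (A B C : act_data) (m2 : mor_data B C) (m1 : mor_data A B)
    : mor_data A C :=
  MorData (mul_comp (mor_hom m2) (mor_hom m1))
          (pcomp (mor_map m1) (mor_map m2)).

Lemma mor_idP (A : act_data) : is_proper_morphism (mor_id A).
Proof.
split; last by move=> C; rewrite ppreim_id.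
split; first exact: is_pmap_id.
  by move=> s; rewrite ppreim_id.
by move=> s y _; rewrite /pcomp /=; case: (act_map s y).
Qed.

Lemma mor_compP (A B C : act_data) (m2 : mor_data B C) (m1 : mor_data A B) :
  is_proper_morphism m2 -> is_proper_morphism m1 ->
  is_proper_morphism (mor_comp m2 m1).
Proof.
move=> [[c2 d2 e2] p2] [[c1 d1 e1] p1].
split; last by move=> V cV; rewrite ppreim_comp; exact/p2/p1.
split; first exact: is_pmap_comp.
  by move=> s; rewrite ppreim_comp d1 d2.
move=> s y; rewrite /= ppreim_comp => /ppreimE[x yx xD].
have := e1 s x xD; have : ppreim (mor_map m2) (pdom (act_map (mor_hom m1 s))) y.
  by apply/ppreimE; exists x => //; rewrite -d1.
move=> /e2; rewrite /pcomp yx /= => -> ->.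
by case: (act_map _ y).
Qed.

Lemma mor_data_eq (A B : act_data) (m n : mor_data A B) :
  mor_hom m =1 mor_hom n -> mor_map m =1 mor_map n -> m = n.
Proof.
case: m n => [f xi] [g eta] /= /multiplicative_eq -> /funext ->.
by [].
Qed.

Definition lcH_action := {A : act_data | is_lcH_action A}.

Definition proper_morphism (A B : lcH_action) :=
  {m : mor_data (sval A) (sval B) | is_proper_morphism m}.

Definition proper_id (A : lcH_action) : proper_morphism A A :=
  exist _ (mor_id (sval A)) (mor_idP (sval A)).

Definition proper_comp (A B C : lcH_action) (n : proper_morphism B C)
    (m : proper_morphism A B) : proper_morphism A C :=
  exist _ (mor_comp (sval n) (sval m)) (mor_compP (svalP n) (svalP m)).

Lemma proper_morphism_eq (A B : lcH_action) (m n : proper_morphism A B) :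
  sval m = sval n -> m = n.
Proof. by case: m n => [m mP] [n nP] /= mn; exact: eq_exist. Qed.

Lemma proper_comp1m (A B : lcH_action) (m : proper_morphism A B) :
  proper_comp (proper_id B) m = m.
Proof.
by apply: proper_morphism_eq; apply: mor_data_eq.
Qed.

Lemma proper_compm1 (A B : lcH_action) (m : proper_morphism A B) :
  proper_comp m (proper_id A) = m.
Proof.
apply: proper_morphism_eq; apply: mor_data_eq => //= y.
by rewrite /pcomp; case: (mor_map _ y).
Qed.

Lemma proper_compA (A B C D : lcH_action) (p : proper_morphism C D)
    (n : proper_morphism B C) (m : proper_morphism A B) :
  proper_comp p (proper_comp n m) = proper_comp (proper_comp p n) m.
Proof.
apply: proper_morphism_eq; apply: mor_data_eq => //= y.
by rewrite /pcomp; case: (mor_map (sval p) y).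
Qed.

Definition ISA_lcH : category :=
  Category proper_comp1m proper_compm1 proper_compA.

(* Main.v *)
Require Import Defs.
From mathcomp Require Import all_boot.
From HB Require Import structures.
From mathcomp Require Import all_classical topology.

Set Implicit Arguments.
Unset Strict Implicit.
Unset Printing Implicit Defensive.

Local Open Scope classical_set_scope.
Local Open Scope group_scope.

(** Everything reduces to one construction: pulling characters back along a
    homomorphism [phi : E(S) -> E(T)] of idempotent semigroups. The map
    [z |-> z \o phi] between the full character spaces [spec0 T] and [spec0 S]
    is total and continuous ([char_pull_continuous]). Restricting it to the
    nonzero characters whose pullback is again nonzero gives the partial map
    [spec_pull phi] between the spectra.

    Both ingredients of the statement have this form. The dual map of
    [theta] is [spec_pull] of the restriction of [theta] to idempotents
    ([dual_mapE]), and [beta s] is [spec_pull] of the conjugation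
    [e |-> star s * e * s] ([betaE]): a character [z] satisfies
    [z (star s * e * s) = 1] for some [e] exactly when [z (star s * s) = 1], so
    nonvanishing of the pullback cuts out the prescribed domain.

    Topologically, [spec0 S] is a closed subspace of a power of the
    two-point space, hence compact Hausdorff, and [spec S] is locally compact
    because the sets [Uidem e] are open, compact and cover it. A partial map
    [spec_pull phi] has open domain, the union of the [Uidem (phi e)], and is
    proper because the preimage of a compact [C] is also the full preimage of
    [C] in the compact space [spec0 T]: a character with nonzero pullback is
    nonzero ([val_ppreim_spec_pull]).

    Algebraically, [spec_pull] reverses compositions ([spec_pull_comp]). So
    multiplicativity of [beta], equivariance of the dual map and
    functoriality are the identities
    [idem_conjgM], [idem_mor_conjg] and [(g \o f)|E = g|E \o f|E] between maps of
    idempotents. *)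

(** * Subspaces and products *)

(** Compactness is intrinsic; this is what lets compactness in a spectrum be
    tested in the compact space of all characters. *)
Lemma compact_subtype (X : topologicalType) (A : set X) (B : set A) :
  compact (set_val @` B) <-> compact B.
Proof.
split=> cB; last first.
  apply: continuous_compact cB; apply: continuous_subspaceT.
  exact: initial_continuous.
move=> F FF FB.
have [|p [[b Bb <-] clb]] := cB (set_val @ F).
  by apply: (@filterS _ F _ B) => // x Bx; exists x.
exists b; split=> // U V FU [_ [[W oW <-] Wb WV]].
have FU' : (set_val @ F) (set_val @` U).
  by apply: (@filterS _ F _ U) => // x Ux; exists x.
have Wb' : nbhs (set_val b) W by apply: open_nbhs_nbhs.
have [_ [[u Uu <-] Wu]] := clb _ _ FU' Wb'.
by exists u; split=> //; apply: WV.
Qed.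

Lemma continuous_inj_hausdorff (X Y : topologicalType) (f : X -> Y) :
  continuous f -> injective f -> hausdorff_space Y -> hausdorff_space X.
Proof.
move=> cf fI hY p q clq; apply/fI/hY => U V /cf pU /cf qV.
by have [x [Ux Vx]] := clq _ _ pU qV; exists (f x).
Qed.

Lemma hausdorff_subtype (X : topologicalType) (A : set X) :
  hausdorff_space X -> hausdorff_space (set_type A).
Proof.
exact: continuous_inj_hausdorff (@initial_continuous _ _ _) val_inj.
Qed.

(** The product topology is the supremum of the topologies initial for the
    projections, so both universal properties apply in turn. *)
Lemma continuous_into_prod (I : eqType) (K : I -> topologicalType)
    (X : topologicalType) (f : X -> prod_topology K) :
  (forall i, continuous (fun x => f x i)) -> continuous f.
Proof.
move=> cf x; apply/cvg_sup => i.
exact: (@continuous_comp_initial _ _ _ (proj i) f (cf i)).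
Qed.

(** * Semigroup homomorphisms and involution *)

Lemma morph_star (S T : invSemigroupType) (theta : {multiplicative S -> T}) s :
  theta (star s) = star (theta s).
Proof. by apply: star_uniq; rewrite -!gmulfM ?mulKstar ?starKmul. Qed.

(** The idempotents [t * star t] and [star s * s] in the middle of
    [s * t * (star t * star s) * (s * t)] commute, after which [s] and [t]
    absorb them. *)
Lemma starM (S : invSemigroupType) (s t : S) :
  star (s * t) = star t * star s.
Proof.
have comm := idem_comm (idem_mulstar t) (idem_starmul s).
apply/esym/star_uniq.
  transitivity (s * ((t * star t) * (star s * s)) * t); first by rewrite !mulgA.
  by rewrite comm !mulgA mulKstar -!mulgA (mulgA t) mulKstar.
transitivity (star t * ((star s * s) * (t * star t)) * star s).
  by rewrite !mulgA.
by rewrite -comm !mulgA starKmul -!mulgA (mulgA (star s)) starKmul.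
Qed.

Section IdempotentMaps.
Variables (S T : invSemigroupType) (theta : {multiplicative S -> T}).

Lemma idem_mor_multiplicative : {morph idem_mor theta : e f / e * f}.
Proof. by move=> e f; apply/val_inj/gmulfM. Qed.

HB.instance Definition _ :=
  isMultiplicative.Build (idem_of S) (idem_of T) (idem_mor theta)
    idem_mor_multiplicative.

Lemma idem_conjg_multiplicative (s : S) : {morph idem_conjg s : e f / e * f}.
Proof. by move=> e f; apply/val_inj/conj_mul/eqP/(valP e). Qed.

HB.instance Definition _ (s : S) :=
  isMultiplicative.Build (idem_of S) (idem_of S) (idem_conjg s)
    (idem_conjg_multiplicative s).

Lemma idem_conjgM (s t : S) e :
  idem_conjg (s * t) e = idem_conjg t (idem_conjg s e).
Proof. by apply/val_inj; rewrite /= starM !mulgA. Qed.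

(** Conjugating by [star s] and then by [s] only cuts down to the idempotent
    [star s * s], on which characters in the domain of [beta s] take the value
    1; this makes [beta s] and [beta (star s)] mutually inverse. *)
Lemma idem_conjg_star (s : S) e :
  idem_conjg s (idem_conjg (star s) e) = idem_dom s * e * idem_dom s.
Proof. by apply/val_inj; rewrite /= starK !mulgA. Qed.

Lemma idem_conjg_dom (s : S) e : idem_conjg s e = idem_conjg s e * idem_dom s.
Proof. by apply/val_inj; rewrite /= -!mulgA (mulgA s) mulKstar. Qed.

Lemma idem_conjg_cod (s : S) : idem_conjg s (idem_dom (star s)) = idem_dom s.
Proof. by apply/val_inj; rewrite /= starK mulgA starKmul. Qed.

Lemma idem_dom_idem (e : idem_of S) : idem_dom (val e) = e.
Proof.
by have /eqP ee := valP e; apply/val_inj; rewrite /= (idem_starE ee).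
Qed.

Lemma idem_mor_dom (s : S) : idem_mor theta (idem_dom s) = idem_dom (theta s).
Proof. by apply/val_inj; rewrite /= gmulfM morph_star. Qed.

Lemma idem_mor_conjg (s : S) e :
  idem_mor theta (idem_conjg s e) = idem_conjg (theta s) (idem_mor theta e).
Proof. by apply/val_inj; rewrite /= !gmulfM morph_star. Qed.

End IdempotentMaps.

(** * The spectrum *)

Section Spectrum.
Variable S : invSemigroupType.
Implicit Types z w : spec S.

Lemma spec0_funM (z : spec0 S) e f :
  spec0_fun z (e * f) = spec0_fun z e && spec0_fun z f.
Proof. exact: (set_mem (valP z)). Qed.

Lemma spec_funM z e f : spec_fun z (e * f) = spec_fun z e && spec_fun z f.
Proof. exact: spec0_funM. Qed.

Lemma spec_fun_inj : injective (@spec_fun S).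
Proof. by move=> z w /val_inj/val_inj. Qed.

Lemma nonzero_charP (u : spec0 S) :
  nonzero_char S u <-> exists e, spec0_fun u e.
Proof.
split=> [u0|[e ue] u0]; last by rewrite u0 in ue.
by apply/not_existsP => h; apply: u0; apply/funext => e; apply/negbTE/negP/h.
Qed.

Lemma spec_neq0 z : exists e, spec_fun z e.
Proof. exact/nonzero_charP/(set_mem (valP z)). Qed.

Lemma spec0_eval_continuous e : continuous (fun z : spec0 S => spec0_fun z e).
Proof.
move=> z; apply: (@continuous_comp _ _ _ (set_val : spec0 S -> {ptws idem_of S -> bool})
  (fun f => f e)).
  exact: initial_continuous.
exact: (@proj_continuous _ (fun=> bool) e).
Qed.

Lemma spec_val_continuous : continuous (val : spec S -> spec0 S).
Proof. exact: initial_continuous. Qed.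

Lemma spec0_eval_open e : open [set z : spec0 S | spec0_fun z e].
Proof.
have /continuousP/(_ [set true]) := @spec0_eval_continuous e.
by apply; exact: discrete_open.
Qed.

Lemma Uidem_open (e : idem_of S) : open (Uidem e).
Proof. by exists [set z | spec0_fun z e] => //; exact: spec0_eval_open. Qed.

(** Being a character is a condition on three coordinates at a time, and
    prescribing finitely many coordinates defines a neighbourhood. *)
Lemma is_char_closed : closed (is_char S).
Proof.
have nbhs_eval (p : {ptws idem_of S -> bool}) (e : idem_of S) :
    nbhs p [set q : {ptws idem_of S -> bool} | q e = p e].
  exact: (@proj_continuous _ (fun=> bool) e p [set p e] (discrete_set1 _)).
move=> p clp e f.
have [q [qP [/= [<- <-] <-]]] := clp _
  (filterI (filterI (nbhs_eval p e) (nbhs_eval p f)) (nbhs_eval p (e * f))).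
exact: qP.
Qed.

Lemma spec0_compact : compact [set: spec0 S].
Proof.
apply/compact_subtype.
have bc := @tychonoff (idem_of S) (fun=> bool) _ (fun=> bool_compact).
apply: (subclosed_compact _ bc) => //.
suff -> : set_val @` [set: spec0 S] = is_char S by exact: is_char_closed.
apply/seteqP; split=> [_ [z _ <-]|z zP]; first exact: (set_mem (valP z)).
by exists (exist _ z (mem_set zP)).
Qed.

Lemma spec0_hausdorff : hausdorff_space (spec0 S).
Proof.
apply: hausdorff_subtype.
apply: (@hausdorff_product _ (fun=> bool)) => _; exact: discrete_hausdorff.
Qed.

Lemma spec_hausdorff : hausdorff_space (spec S).
Proof. exact/hausdorff_subtype/spec0_hausdorff. Qed.

(** [spec S] itself need not be compact, as the zero character may be a limit
    of nonzero ones. Closedness in [spec0 S] says that the zero character is no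
    limit of [A] either. *)
Lemma compact_spec (A : set (spec S)) (B : set (spec0 S)) :
  set_val @` A = B -> closed B -> compact A.
Proof.
by move=> AB cB; apply/compact_subtype; rewrite AB;
  apply: subclosed_compact cB spec0_compact _.
Qed.

Lemma Uidem_compact (e : idem_of S) : compact (Uidem e).
Proof.
apply: (@compact_spec _ [set z : spec0 S | spec0_fun z e]).
  apply/seteqP; split=> [_ [z ze <-] //|z ze].
  have z0 : nonzero_char S z by apply/nonzero_charP; exists e.
  by exists (exist _ z (mem_set z0)).
have [+ _] := continuous_closedP (fun z : spec0 S => spec0_fun z e).
move=> /(_ (@spec0_eval_continuous e)) /(_ [set true]); apply.
exact: discrete_closed.
Qed.

Lemma spec_locally_compact : locally_compact [set: spec S].
Proof.
move=> z _; have [e ze] := spec_neq0 z.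
exists (Uidem e); last first.
  split; first exact: Uidem_compact.
  by apply: compact_closed; [exact: spec_hausdorff|exact: Uidem_compact].
apply: (@filterS _ (nbhs z) _ (Uidem e)) => //.
by apply: open_nbhs_nbhs; split=> //; exact: Uidem_open.
Qed.

Lemma insub_specP (u : spec0 S) w :
  insub u = Some w <-> spec_fun w = spec0_fun u.
Proof.
split; first by case: insubP => // w' _ <- [<-].
by move=> /val_inj <-; exact: valK.
Qed.

End Spectrum.

(** * Pulling characters back *)

Lemma pmap_ext (X Y : Type) (f g : X -> option Y) :
  (forall x y, f x = Some y <-> g x = Some y) -> f = g.
Proof.
move=> fg; apply/funext => x.
case fx: (f x) => [y|]; first by apply/esym/fg.
by case gx: (g x) => [y|] //; move/fg: gx; rewrite fx.
Qed.

Section Pullback.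
Variables (S T : invSemigroupType) (phi : {multiplicative idem_of S -> idem_of T}).

Lemma char_pull_subproof (z : spec0 T) : is_char S (spec0_fun z \o phi).
Proof. by move=> e f; rewrite /= gmulfM spec0_funM. Qed.

(** The total map on [spec0 T], zero character included; unlike its partial
    restriction to [spec T], it is defined on a compact space. *)
Definition char_pull (z : spec0 T) : spec0 S :=
  exist (fun u => u \in is_char S) _ (mem_set (char_pull_subproof z)).

Definition spec_pull (z : spec T) : option (spec S) :=
  insub (char_pull (val z)).

Lemma spec_pullP z w : spec_pull z = Some w <-> spec_fun w = spec_fun z \o phi.
Proof. exact: insub_specP. Qed.

Lemma spec_pull_domP z : pdom spec_pull z <-> exists e, spec_fun z (phi e).
Proof.
rewrite /pdom /spec_pull /=; split=> [|[e ze]].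
  by case: insubP => // w + _ _ => /set_mem/nonzero_charP.
by rewrite insubT //; apply/mem_set/nonzero_charP; exists e.
Qed.

Lemma char_pull_continuous : continuous char_pull.
Proof.
apply: (@continuous_comp_initial _ _ _ (val : spec0 S -> _) char_pull).
by apply: continuous_into_prod => e; exact: spec0_eval_continuous.
Qed.

(** The reason for properness: no zero character is lost on the left, since
    the pullback of the zero character is zero and [V] has only nonzero ones. *)
Lemma val_ppreim_spec_pull (V : set (spec S)) :
  val @` ppreim spec_pull V = char_pull @^-1` (val @` V).
Proof.
apply/seteqP; split=> [_ [z /ppreimE[w zw Vw] <-]|z [w Vw wz]].
  by exists w => //; move/spec_pullP: zw => wz; apply/val_inj.
have [e we] := spec_neq0 w.
have ze : nonzero_char T z.
  by apply/nonzero_charP; exists (phi e); move: we; rewrite /spec_fun wz.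
exists (exist _ z (mem_set ze)) => //; apply/ppreimE; exists w => //.
by apply/spec_pullP; rewrite /spec_fun wz.
Qed.

Lemma spec_pull_dom_open : open (pdom spec_pull).
Proof.
suff -> : pdom spec_pull = \bigcup_e Uidem (phi e).
  by apply: bigcup_open => e _; exact: Uidem_open.
apply/seteqP; split=> z; first by move/spec_pull_domP=> [e ze]; exists e.
by move=> [e _ ze]; apply/spec_pull_domP; exists e.
Qed.

Lemma spec_pull_pmap : is_pmap spec_pull.
Proof.
apply/is_pmapP => _ [W oW <-].
suff -> : ppreim spec_pull (val @^-1` W) =
    pdom spec_pull `&` (char_pull \o val) @^-1` W.
  apply: openI; first exact: spec_pull_dom_open.
  have /continuousP := char_pull_continuous => /(_ _ oW).
  by have /continuousP := @spec_val_continuous T; exact.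
have valE z w : spec_pull z = Some w -> val w = char_pull (val z).
  by move/spec_pullP => wz; apply/val_inj.
apply/seteqP; split=> z; rewrite ppreimE.
  by move=> [w zw Ww]; split; [rewrite /pdom /= zw|rewrite /= -(valE _ _ zw)].
rewrite /pdom => -[] /=; case zw: (spec_pull z) => [w|//] _.
by rewrite -(valE _ _ zw) => Ww; exists w.
Qed.

Lemma spec_pull_proper : pproper spec_pull.
Proof.
move=> C /compact_subtype cC; apply: compact_spec (val_ppreim_spec_pull C) _.
have /continuous_closedP := char_pull_continuous; apply.
exact: compact_closed (@spec0_hausdorff S) cC.
Qed.

End Pullback.

(** The domains agree because a nonzero pullback along [phi \o psi] forces the
    intermediate pullback along [phi] to be nonzero. *)
Lemma spec_pull_comp (R S T : invSemigroupType)
    (phi : {multiplicative idem_of S -> idem_of T})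
    (psi : {multiplicative idem_of R -> idem_of S}) :
  spec_pull (phi \o psi) = pcomp (spec_pull psi) (spec_pull phi).
Proof.
apply: pmap_ext => z w; rewrite spec_pullP /pcomp.
case zv: (spec_pull phi z) => [v|] /=.
  by move/spec_pullP: zv => vz; rewrite spec_pullP vz.
split=> // wz; have [e we] := spec_neq0 w.
suff : pdom (spec_pull phi) z by rewrite /pdom /= zv.
by apply/spec_pull_domP; exists (psi e); move: we; rewrite wz.
Qed.

Lemma spec_pull_ext (S T : invSemigroupType)
    (phi psi : {multiplicative idem_of S -> idem_of T}) :
  phi =1 psi -> spec_pull phi = spec_pull psi.
Proof. by move=> /funext e; apply: pmap_ext => z w; rewrite !spec_pullP e. Qed.

Lemma spec_pull_id (S : invSemigroupType)
    (phi : {multiplicative idem_of S -> idem_of S}) :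
  phi =1 id -> spec_pull phi = some.
Proof.
move=> /funext e; apply: pmap_ext => z w; rewrite spec_pullP e.
by split=> [/spec_fun_inj ->|[->]].
Qed.

(** * The spectral functor *)

Lemma dual_mapE (S T : invSemigroupType) (theta : {multiplicative S -> T}) :
  dual_map theta = spec_pull (idem_mor theta).
Proof. by apply: pmap_ext => z w; rewrite spec_pullP /dual_map insub_specP. Qed.

Section SpectralAction.
Variable S : invSemigroupType.
Implicit Types s t : S.

(** Since [star s * e * s] lies below [star s * s], which is itself the
    conjugate of [s * star s], the domain of [beta s] consists of the
    characters whose pullback along conjugation by [s] is nonzero. *)
Lemma UeltP s (z : spec S) : Uelt s z <-> exists e, spec_fun z (idem_conjg s e).
Proof.
split=> [sz|[e]]; first by exists (idem_dom (star s)); rewrite idem_conjg_cod.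
by rewrite idem_conjg_dom spec_funM => /andP[].
Qed.

Lemma betaE s : beta s = spec_pull (idem_conjg s).
Proof.
apply: pmap_ext => z w; rewrite spec_pullP /beta.
case: pselect => [sz|nsz].
  by split=> [[<-] //|wz]; congr Some; apply: spec_fun_inj; rewrite wz.
split=> // wz; case: nsz; apply/UeltP.
by have [e we] := spec_neq0 w; exists e; move: we; rewrite wz.
Qed.

Lemma beta_domE s : pdom (beta s) = Uelt s.
Proof.
by rewrite betaE; apply/seteqP; split=> z;
  [move/spec_pull_domP/UeltP|move/UeltP/spec_pull_domP].
Qed.

Lemma betaM s t : beta (s * t) = pcomp (beta s) (beta t).
Proof.
rewrite !betaE -spec_pull_comp; apply: spec_pull_ext; exact: idem_conjgM.
Qed.

Lemma beta_star s (z w : spec S) :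
  beta s z = Some w -> beta (star s) w = Some z.
Proof.
move=> zw; have sz : Uelt s z by rewrite -beta_domE /pdom /= zw.
move: zw; rewrite !betaE !spec_pullP => ->; apply/funext => e /=.
by rewrite idem_conjg_star !spec_funM [spec_fun z (idem_dom s)]sz andbT.
Qed.

Lemma spectral_act_lcH : is_lcH_action (spectral_act S).
Proof.
split; [split|exact: spec_locally_compact|exact: spec_hausdorff].
- move=> s; split; first by rewrite /= betaE; exact: spec_pull_pmap.
  exists (beta (star s)); split; first by rewrite betaE; exact: spec_pull_pmap.
  by move=> z w; split=> /beta_star //; rewrite starK.
- exact: betaM.
apply/seteqP; split=> // z _; have [e ze] := spec_neq0 z.
by exists (val e) => //=; rewrite beta_domE /Uelt idem_dom_idem.
Qed.

End SpectralAction.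

(** Both sides are pullbacks, along the two sides of
    [theta (star s * e * s) = star (theta s) * theta e * theta s]. *)
Lemma dual_map_equivariant (S T : invSemigroupType)
    (theta : {multiplicative S -> T}) s :
  pcomp (beta s) (dual_map theta) = pcomp (dual_map theta) (beta (theta s)).
Proof.
rewrite dual_mapE !betaE -!spec_pull_comp.
by apply: spec_pull_ext => e /=; exact: idem_mor_conjg.
Qed.

Lemma spectral_mor_proper (S T : invSemigroupType)
    (theta : {multiplicative S -> T}) :
  is_proper_morphism (spectral_mor theta).
Proof.
split; last by rewrite /= dual_mapE; exact: spec_pull_proper.
split=> /=; first by rewrite dual_mapE; exact: spec_pull_pmap.
  move=> s; rewrite !beta_domE dual_mapE; apply/seteqP; split=> z.
    move=> /ppreimE[w /spec_pullP wz].
    by rewrite /Uelt /Uidem /= wz /= idem_mor_dom.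
  rewrite /Uelt /Uidem /= -idem_mor_dom => sz.
  have : pdom (spec_pull (idem_mor theta)) z.
    by apply/spec_pull_domP; exists (idem_dom s).
  rewrite /pdom /=; case zw: spec_pull => [w|//] _.
  by apply/ppreimE; exists w => //; move/spec_pullP: zw;
    rewrite /Uelt /Uidem /= => ->.
by move=> s z _; rewrite -[LHS]/(pcomp (beta s) (dual_map theta) z)
  dual_map_equivariant.
Qed.

Lemma dual_map_id (S : invSemigroupType) : dual_map (mul_id S) = some.
Proof. by rewrite dual_mapE; apply: spec_pull_id => e; apply/val_inj. Qed.

Lemma dual_map_comp (S T U : invSemigroupType)
    (g : {multiplicative T -> U}) (f : {multiplicative S -> T}) :
  dual_map (mul_comp g f) = pcomp (dual_map f) (dual_map g).
Proof.
rewrite !dual_mapE -spec_pull_comp.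
by apply: spec_pull_ext => e; apply/val_inj.
Qed.

Theorem theorem3p12 :
  exists (HO : forall S : IS, is_lcH_action (spectral_act S))
         (HM : forall (S T : IS) (theta : hom S T),
             is_proper_morphism (spectral_mor theta)),
    @is_functor IS ISA_lcH
      (fun S => exist is_lcH_action (spectral_act S) (HO S))
      (fun S T theta =>
         exist (@is_proper_morphism (spectral_act S) (spectral_act T))
               (spectral_mor theta) (HM S T theta)).
Proof.
exists spectral_act_lcH, spectral_mor_proper; split=> [S|S T U g f].
  apply: proper_morphism_eq; apply: mor_data_eq => //= z.
  by rewrite dual_map_id.
apply: proper_morphism_eq; apply: mor_data_eq => //= z.
by rewrite dual_map_comp.
Qed.
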